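(* For every integer $n\geq 1$, the number of even involutions in $\mathfrak{I}_n(132)$ equals $\binom{n-1}{2\lfloor (n+1)/4\rfloor}$, and the number of odd involutions in $\mathfrak{I}_n(132)$ equals $\binom{n-1}{1+2\lfloor (n-2)/4\rfloor}$.
   Context: $\mathfrak{S}_n$ is the symmetric group on $\{1,\dots,n\}$, permutations written in one-line notation $\pi=\pi_1\pi_2\cdots\pi_n$. An involution is a permutation with $\pi=\pi^{-1}$; $\mathfrak{I}_n$ is the set of involutions in $\mathfrak{S}_n$. A permutation $\pi$ contains a pattern $\tau\in\mathfrak{S}_k$ if some subsequence $\pi_{i_1}\cdots\pi_{i_k}$ ($i_1<\dots<i_k$) is order-isomorphic to $\tau$, and avoids $\tau$ otherwise; $\mathfrak{I}_n(132)$ is the set of involutions in $\mathfrak{I}_n$ avoiding $132$. An inversion of $\pi$ is a pair $i<j$ with $\pi_i>\pi_j$; $\pi$ is even (odd) if its number of inversions is even (odd). $\lfloor\cdot\rfloor$ is the floor function and $\binom{a}{b}=0$ if $b<0$ or $b>a$. *)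

(* Defs.v *)
From mathcomp Require Import all_boot all_order all_algebra all_fingroup.

Set Implicit Arguments.
Unset Strict Implicit.
Unset Printing Implicit Defensive.

(* Permutations of {1, ..., n} are elements of 'S_n, which permutes            *)
(* {0, ..., n - 1}: positions and values are both shifted down by one.         *)

Definition involutions (n : nat) : {set 'S_n} := [set s | s == s^-1%g].

Definition contains (n k : nat) (s : 'S_n) (t : 'S_k) : bool :=
  [exists i : {ffun 'I_k -> 'I_n},
     [forall a : 'I_k, forall b : 'I_k, (a < b) ==> (i a < i b)] &&
     [forall a : 'I_k, forall b : 'I_k, (s (i a) < s (i b)) == (t a < t b)]].

Definition avoids (n k : nat) (s : 'S_n) (t : 'S_k) : bool := ~~ contains s t.

Definition pattern132 : 'S_3 := tperm (inord 1) (inord 2).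

Lemma pattern132E : [seq val (pattern132 a) | a <- enum 'I_3] = [:: 0; 2; 1].
Proof.
rewrite enum_ordSl enum_ordSl enum_ordSl enum_ord0 /= /pattern132.
have e1 : lift ord0 ord0 = inord 1 :> 'I_3 by apply/val_inj; rewrite /= inordK.
have e2 : lift ord0 (lift ord0 ord0) = inord 2 :> 'I_3
  by apply/val_inj; rewrite /= inordK.
by rewrite e1 e2 tpermL tpermR tpermD ?inordK // -val_eqE /= inordK.
Qed.

Definition involutions_avoiding (n k : nat) (t : 'S_k) : {set 'S_n} :=
  [set s in involutions n | avoids s t].

Definition inversions (n : nat) (s : 'S_n) : {set 'I_n * 'I_n} :=
  [set p : 'I_n * 'I_n | (p.1 < p.2) && (s p.2 < s p.1)].

Definition even_permutation (n : nat) (s : 'S_n) : bool :=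
  ~~ odd #|inversions s|.

Definition odd_permutation (n : nat) (s : 'S_n) : bool :=
  odd #|inversions s|.

(* The lower index may be negative: for n = 1 the second binomial coefficient  *)
(* of the theorem is binomial (0, -1).                                         *)
Definition binz (a : nat) (b : int) : nat :=
  match b with
  | Posz m => 'C(a, m)
  | Negz _ => 0
  end.

(* Main.v *)
(* Consider the last entry (entries being numbered from 0) of a 132-avoiding
   involution s of size n: either it is fixed, or it lies in a 2-cycle (m, last)
   and removing that cycle leaves a 132-avoiding involution r of size n - 2
   having m as a "site", i.e. the first m values of r exceed all the others and
   are at least m. Inserting a cycle at a site m keeps the number of fixed
   points, flips the sign, and produces the sites 0 and p + 1 for the sites p >=
   m of r; inserting a fixed point leaves only the site 0. Hence the number of
   involutions with k fixed points and more than t sites is the ballot number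
   B(n - t, k + t), where B(n, k) counts the n-step nonnegative lattice paths
   from 0 to k. With j 2-cycles, so that k = n - 2j and the sign is (-1)^j, this
   is C(n, j) - C(n, j - 1) = C(n - 1, j) - C(n - 1, j - 2), and the sum over j
   of fixed parity telescopes. *)
Require Import Defs.
From mathcomp Require Import all_boot all_order all_algebra all_fingroup.
From mathcomp Require Import zify.

Set Implicit Arguments.
Unset Strict Implicit.
Unset Printing Implicit Defensive.

(** * Pointwise form of being a 132-avoiding involution *)

Local Notation inv132 n := (involutions_avoiding n pattern132).

Lemma avoids132P n (s : 'S_n) :
  reflect (forall i j k : 'I_n, i < j -> j < k -> ~~ (s i < s k < s j))
          (avoids s pattern132).
Proof.
have p0 : pattern132 ord0 = ord0 by rewrite tpermD // -val_eqE /= inordK.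
have p1 : pattern132 (inord 1) = inord 2 by rewrite tpermL.
have p2 : pattern132 (inord 2) = inord 1 by rewrite tpermR.
have E3 (a : 'I_3) : [\/ a = ord0, a = inord 1 | a = inord 2].
  by case: a => -[|[|[|]]] //= lta; [constructor 1|constructor 2|constructor 3];
     apply: val_inj; rewrite /= ?inordK.
apply: (iffP idP) => [av i j k ij jk|av].
  apply: contra av => /andP[ik kj].
  apply/existsP; exists [ffun a : 'I_3 => nth i [:: i; j; k] a].
  apply/andP; split; apply/forallP => a; apply/forallP => b; rewrite !ffunE;
    by case: (E3 a) => ->; case: (E3 b) => ->; rewrite ?p0 ?p1 ?p2 ?inordK //=;
       rewrite ?inordK //=; lia.
apply/existsP => -[f /andP[/forallP inc /forallP ord]].
have lt01 := implyP (forallP (inc ord0) (inord 1)).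
have lt12 := implyP (forallP (inc (inord 1)) (inord 2)).
have /eqP e02 := forallP (ord ord0) (inord 2).
have /eqP e21 := forallP (ord (inord 2)) (inord 1).
move: lt01 lt12 e02 e21; rewrite p0 p1 p2 !inordK //= => lt01 lt12 e02 e21.
by move: (av _ _ _ (lt01 isT) (lt12 isT)); rewrite e02 e21.
Qed.

Lemma inv132P n (s : 'S_n) :
  reflect (involutive s /\
           forall i j k : 'I_n, i < j -> j < k -> ~~ (s i < s k < s j))
          (s \in inv132 n).
Proof.
rewrite inE inE; apply: (iffP andP) => -[invs /avoids132P av]; split=> //.
  by move=> i; rewrite {1}(eqP invs) permK.
by rewrite eq_sym eq_invg_mul; apply/eqP/permP => i; rewrite permM perm1 invs.
Qed.

(** * Inserting a last fixed point or a 2-cycle through the last position *)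

Lemma lift_max n (i : 'I_n) : lift ord_max i = i :> nat.
Proof. by rewrite /= /bump leqNgt ltn_ord. Qed.

Lemma lift_perm_inj n (i j : 'I_n.+1) : injective (lift_perm i j).
Proof.
move=> s t st; apply/permP => k; apply: (@lift_inj _ j).
by rewrite -2!(lift_perm_lift i) st.
Qed.

Lemma lift_perm_ex n (i j : 'I_n.+1) (s : 'S_n.+1) :
  s i = j -> exists t, s = lift_perm i j t.
Proof.
(* [f] is [s] with position [i] and value [j] deleted; the default [k] is never taken, since only
   [i] is sent to [j]. *)
move=> sij; pose f k := odflt k (unlift j (s (lift i k))).
have fE k : lift j (f k) = s (lift i k).
  rewrite /f; case: unliftP => [k' -> //|/=]; rewrite -sij => /perm_inj e.
  by have := neq_lift i k; rewrite e eqxx.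
have f_inj : injective f.
  by move=> k k' /(congr1 (lift j)); rewrite !fE => /perm_inj /lift_inj.
exists (perm f_inj); apply/permP => k; case: (unliftP i k) => [k'|] ->.
  by rewrite lift_perm_lift permE fE.
by rewrite lift_perm_id.
Qed.

Definition fix_ins n (s : 'S_n) : 'S_n.+1 := lift_perm ord_max ord_max s.

(** The inner step sends position [m] to the largest value; the outer one appends a position with
    value [m] and shifts the values from [m] on up, so [m] ends up sent to the new last index. *)
Definition cyc_ins n (m : 'I_n.+1) (s : 'S_n) : 'S_n.+2 :=
  lift_perm ord_max (lift ord_max m) (lift_perm m ord_max s).

Section CycIns.
Variables (n : nat) (m : 'I_n.+1) (s : 'S_n).

Definition skip2 (k : 'I_n) : 'I_n.+2 := lift ord_max (lift m k).

Lemma skip2E k : skip2 k = bump m k :> nat.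
Proof. by rewrite lift_max. Qed.

Variant skip2_spec (x : 'I_n.+2) : Type :=
| Skip2Last of x = ord_max
| Skip2Mid of x = lift ord_max m
| Skip2Val k of x = skip2 k.

Lemma skip2P x : skip2_spec x.
Proof.
case: (unliftP ord_max x) => [y|]; last exact: Skip2Last.
by case: (unliftP m y) => [z|] -> ->; [exact: (@Skip2Val _ z)|exact: Skip2Mid].
Qed.

Lemma cyc_ins_last : cyc_ins m s ord_max = lift ord_max m.
Proof. exact: lift_perm_id. Qed.

Lemma cyc_ins_mid : cyc_ins m s (lift ord_max m) = ord_max.
Proof.
rewrite /cyc_ins lift_perm_lift lift_perm_id; apply: val_inj => /=.
by have := ltn_ord m; rewrite /bump; lia.
Qed.

Lemma cyc_ins_skip2 k : cyc_ins m s (skip2 k) = skip2 (s k).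
Proof.
rewrite /cyc_ins /skip2 !lift_perm_lift; apply: val_inj => /=; rewrite /bump.
have := ltn_ord m; have := ltn_ord (s k); lia.
Qed.

Lemma cyc_ins_involutive : involutive s <-> involutive (cyc_ins m s).
Proof.
split=> sK x; last first.
  by have := sK (skip2 x); rewrite !cyc_ins_skip2 => /lift_inj/lift_inj.
case: (skip2P x) => [||k] ->; first by rewrite cyc_ins_last cyc_ins_mid.
  by rewrite cyc_ins_mid cyc_ins_last.
by rewrite !cyc_ins_skip2 sK.
Qed.

End CycIns.
Arguments skip2P {n} m x.

(** * Sites, and how insertions act on them *)

Definition site n (s : 'S_n) (m : nat) : bool :=
  [&& m <= n, [forall i : 'I_n, (i < m) ==> (m <= s i)]
    & [forall i : 'I_n, forall k : 'I_n, (i < m <= k) ==> (s k < s i)]].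

Lemma siteP n (s : 'S_n) (m : nat) :
  reflect [/\ m <= n, forall i : 'I_n, i < m -> m <= s i
            & forall i k : 'I_n, i < m -> m <= k -> s k < s i] (site s m).
Proof.
apply: (iffP and3P) => -[mn lo hi]; split=> //.
- by move=> i im; apply: (implyP (forallP lo i)).
- by move=> i k im mk; apply: (implyP (forallP (forallP hi i) k)); rewrite im.
- by apply/forallP => i; apply/implyP; apply: lo.
by apply/forallP => i; apply/forallP => k; apply/implyP => /andP[]; apply: hi.
Qed.

Lemma site0 n (s : 'S_n) : site s 0.
Proof. by apply/siteP; split. Qed.

(** The entry at [m] is the maximum and the last entry is [m]. Triples (i, [m], last) force the
    first [m] values to be at least [m], and triples (i, [m], k) force them above all later ones;
    conversely, these conditions exclude every 132 that uses the new cycle. *)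
Lemma cyc_ins_inv132 n (m : 'I_n.+1) (s : 'S_n) :
  (cyc_ins m s \in inv132 n.+2) = (s \in inv132 n) && site s m.
Proof.
have mn := ltn_ord m.
apply/inv132P/andP => [[csK av]|[/inv132P[sK av] /siteP[_ lo hi]]].
  have sK : involutive s by apply: (cyc_ins_involutive m s).2.
  have lo (i : 'I_n) : i < m -> m <= s i.
    move=> im; have := av (skip2 m i) (lift ord_max m) ord_max.
    rewrite cyc_ins_skip2 cyc_ins_mid cyc_ins_last !skip2E !lift_max /= /bump.
    have := ltn_ord (s i); lia.
  split; last (apply/siteP; split=> // i k im mk).
    apply/inv132P; split=> // i j k ij jk.
    have := av (skip2 m i) (skip2 m j) (skip2 m k).
    rewrite !cyc_ins_skip2 !skip2E /bump; lia.
  have := av (skip2 m i) (lift ord_max m) (skip2 m k).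
  have : s i != s k :> nat.
    by apply/eqP => /val_inj/perm_inj ik; rewrite ik in im; lia.
  rewrite !cyc_ins_skip2 cyc_ins_mid !skip2E !lift_max /= /bump.
  have := lo i im; have := ltn_ord (s i); have := ltn_ord (s k); lia.
split; first exact: (cyc_ins_involutive m s).1.
move=> i j k; case: (skip2P m i) => [||i'] ->;
  case: (skip2P m j) => [||j'] ->; case: (skip2P m k) => [||k'] ->;
  rewrite ?cyc_ins_skip2 ?cyc_ins_mid ?cyc_ins_last ?skip2E ?lift_max;
  rewrite /= /bump; try lia; try (have := ltn_ord k'; lia);
  try (have := ltn_ord i'; lia); try (have := ltn_ord (s k'); lia);
  try (have := ltn_ord (s j'); lia).
- have := lo i'; have := ltn_ord i'; lia.
- have := hi i' k'; have := ltn_ord i'; have := ltn_ord k'; lia.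
  (* If s i < m, the site condition for s i < m <= s j reads j = s (s j) <
     s (s i) = i. *)
- have := lo i'; have := hi (s i') (s j'); rewrite !sK; lia.
have := av i' j' k'; lia.
Qed.

Variant ord_last_spec n (x : 'I_n.+1) : Type :=
| LastMax of x = ord_max
| LastLift (k : 'I_n) of x = lift ord_max k.

Lemma ord_lastP n (x : 'I_n.+1) : ord_last_spec x.
Proof.
case: (unliftP ord_max x) => [k|] ->; last exact: LastMax.
exact: (LastLift (k := k)).
Qed.

Lemma fix_ins_last n (s : 'S_n) : fix_ins s ord_max = ord_max.
Proof. exact: lift_perm_id. Qed.

Lemma fix_ins_lift n (s : 'S_n) k :
  fix_ins s (lift ord_max k) = lift ord_max (s k).
Proof. exact: lift_perm_lift. Qed.

Lemma fix_ins_inv132 n (s : 'S_n) :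
  (fix_ins s \in inv132 n.+1) = (s \in inv132 n).
Proof.
apply/inv132P/inv132P => -[sK av].
  split=> [i|i j k]; first by have := sK (lift ord_max i);
    rewrite !fix_ins_lift => /lift_inj.
  by have := av (lift ord_max i) (lift ord_max j) (lift ord_max k);
    rewrite !fix_ins_lift !lift_max.
split=> [i|i j k].
  by case: (ord_lastP i) => [|i'] ->;
    rewrite ?fix_ins_lift ?fix_ins_last ?sK.
case: (ord_lastP i) => [|i'] ->; case: (ord_lastP j) => [|j'] ->;
  case: (ord_lastP k) => [|k'] ->;
  rewrite ?fix_ins_lift ?fix_ins_last ?lift_max; last exact: av;
  rewrite /=; try (have := ltn_ord j'; have := ltn_ord (s j'); lia);
  try (have := ltn_ord k'; lia); lia.
Qed.

(** The largest value stands last, so no nonempty proper prefix exceeds what follows it; the full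
    prefix fails the lower bound on its values. *)
Lemma site_fix_ins n (s : 'S_n) m : site (fix_ins s) m = (m == 0).
Proof.
case: m => [|m]; first exact: site0.
apply/siteP => -[mn lo hi].
have := hi ord0 ord_max isT; have := lo ord0 isT; rewrite fix_ins_last /=.
have := ltn_ord (fix_ins s ord0); lia.
Qed.

(** Position [m] carries the maximum, so a nonzero site must lie beyond [m]; its prefix then
    consists of [m] and the first [p] old positions. *)
Lemma site_cyc_ins n (m : 'I_n.+1) (s : 'S_n) p :
  site s m -> site (cyc_ins m s) p.+1 = (m <= p) && site s p.
Proof.
move=> /siteP[_ lom _]; have mn := ltn_ord m.
apply/siteP/andP => [[pn lo hi]|[mp /siteP[pn lo hi]]].
  have mp : m <= p.
    have := hi ord0 (lift ord_max m) isT; rewrite cyc_ins_mid lift_max /=.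
    have := ltn_ord (cyc_ins m s ord0); lia.
  split=> //; apply/siteP; split.
  - have := lo (lift ord_max m); rewrite cyc_ins_mid lift_max /=; lia.
  - move=> i ip; have := lo (skip2 m i); rewrite cyc_ins_skip2 !skip2E /bump.
    lia.
  move=> i k ip pk; have := hi (skip2 m i) (skip2 m k).
  rewrite !cyc_ins_skip2 !skip2E /bump; lia.
split; first lia.
  move=> i; case: (skip2P m i) => [||i'] ->;
    rewrite ?cyc_ins_skip2 ?cyc_ins_mid ?cyc_ins_last ?skip2E ?lift_max /=;
    rewrite /bump; try lia.
  have := lo i'; lia.
move=> i k; case: (skip2P m i) => [||i'] ->; case: (skip2P m k) => [||k'] ->;
  rewrite ?cyc_ins_skip2 ?cyc_ins_mid ?cyc_ins_last ?skip2E ?lift_max /=;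
  rewrite /bump; try lia.
- by have := ltn_ord (s k'); lia.
- by have := lo i'; lia.
have := hi i' k'; lia.
Qed.

(** * Fixed points and sign under insertion *)

Definition nfix n (s : 'S_n) : nat := \sum_(i < n) (s i == i).

Lemma sum_ord_lift n (j : 'I_n.+1) (F : 'I_n.+1 -> nat) :
  \sum_i F i = F j + \sum_(k < n) F (lift j k).
Proof. by rewrite (bigD1_ord j). Qed.

Lemma nfix_fix_ins n (s : 'S_n) : nfix (fix_ins s) = (nfix s).+1.
Proof.
rewrite /nfix (sum_ord_lift ord_max) fix_ins_last eqxx add1n; congr _.+1.
by apply: eq_bigr => i _; rewrite fix_ins_lift (inj_eq (@lift_inj _ _)).
Qed.

Lemma nfix_cyc_ins n (m : 'I_n.+1) (s : 'S_n) : nfix (cyc_ins m s) = nfix s.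
Proof.
rewrite /nfix (sum_ord_lift ord_max) (sum_ord_lift m).
rewrite cyc_ins_last cyc_ins_mid [_ == ord_max]eq_sym (negPf (neq_lift _ _)).
rewrite !add0n; apply: eq_bigr => i _; rewrite -[lift _ _]/(skip2 m i).
by rewrite cyc_ins_skip2 /skip2 !(inj_eq (@lift_inj _ _)).
Qed.

Lemma card_inversions n (s : 'S_n) :
  #|inversions s| = \sum_(i < n) \sum_(j < n) ((j < i) && (s i < s j)).
Proof.
rewrite exchange_big pair_big /= -sum1_card big_mkcond /=.
by apply: eq_bigr => -[i j] _; rewrite inE /=; case: ifP.
Qed.

Lemma sum_geq_ord n j : \sum_(k < n) (j <= k) = n - j.
Proof.
elim: n => [|n IH]; first by rewrite big_ord0.
by rewrite big_ord_recr /= IH; lia.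
Qed.

Lemma card_inversions_lift_perm n (j : 'I_n.+1) (s : 'S_n) :
  #|inversions (lift_perm ord_max j s)| = n - j + #|inversions s|.
Proof.
rewrite !card_inversions (sum_ord_lift ord_max); congr (_ + _).
  rewrite (sum_ord_lift ord_max) ltnn add0n lift_perm_id.
  transitivity (\sum_(k < n) (j <= s k)).
    apply: eq_bigr => k _; rewrite lift_perm_lift lift_max ltn_ord /= /bump.
    by congr nat_of_bool; lia.
  transitivity (\sum_(k < n) (j <= k)).
    by rewrite [RHS](reindex_inj (@perm_inj _ s)).
  by rewrite sum_geq_ord.
apply: eq_bigr => i _; rewrite (sum_ord_lift ord_max) !lift_max.
rewrite ltnNge ltnW ?ltn_ord // add0n; apply: eq_bigr => k _.
rewrite !lift_perm_lift !lift_max /= /bump; congr nat_of_bool; lia.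
Qed.

(** Ties the inversion count to the library's sign, whose behaviour under [lift_perm] is known. The
    induction deletes the last entry. *)
Lemma odd_inversions n (s : 'S_n) : odd #|inversions s| = s.
Proof.
elim: n s => [|n IH] s.
  by rewrite [s]permS0 odd_perm1 card_inversions big_ord0.
have [t ->] := lift_perm_ex (erefl (s ord_max)).
rewrite odd_lift_perm card_inversions_lift_perm oddD IH oddB //.
by rewrite -ltnS ltn_ord.
Qed.

Lemma odd_fix_ins n (s : 'S_n) : odd_perm (fix_ins s) = s.
Proof. by rewrite odd_lift_perm addbb. Qed.

Lemma odd_cyc_ins n (m : 'I_n.+1) (s : 'S_n) : odd_perm (cyc_ins m s) = ~~ s.
Proof.
rewrite !odd_lift_perm lift_max /=.
by case: (odd n); case: (odd m); case: (odd_perm s).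
Qed.

(** * Number of sites after an insertion *)

Definition nsites n (s : 'S_n) : nat := count (site s) (iota 0 n.+1).

Lemma nsites_fix_ins n (s : 'S_n) : nsites (fix_ins s) = 1.
Proof.
rewrite /nsites (eq_count (site_fix_ins s)) /= add0n.
rewrite (eq_in_count (a2 := pred0)) ?count_pred0 ?addn0 // => i.
by rewrite mem_iota; case: i.
Qed.

Lemma nsites_cyc_ins n (m : 'I_n.+1) (s : 'S_n) :
  site s m ->
  nsites (cyc_ins m s) =
    (count (fun p => (m <= p) && site s p) (iota 0 n.+1)).+1.
Proof.
move=> sm; rewrite /nsites.
have -> : iota 0 n.+3 = 0 :: map (addn 1) (iota 0 n.+2) by rewrite -iotaDl.
rewrite -cat1s count_cat count_map [count _ [:: 0]]/= site0 addn0 add1n.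
congr _.+1.
rewrite (eq_count (a2 := fun p => (m <= p) && site s p)).
  rewrite -[n.+2]addn1 iotaD count_cat [count _ (iota _ 1)]/= add0n.
  have -> : site s n.+1 = false by apply/siteP => -[]; lia.
  by rewrite andbF !addn0.
by move=> p /=; rewrite site_cyc_ins.
Qed.

(** * Decomposition by the last entry *)

Lemma fix_ins_ex n (s : 'S_n.+1) :
  s \in inv132 n.+1 -> s ord_max = ord_max ->
  exists2 t, t \in inv132 n & s = fix_ins t.
Proof.
move=> sV /lift_perm_ex[t st].
by exists t => //; rewrite -fix_ins_inv132 /fix_ins -st.
Qed.

Lemma cyc_ins_ex n (s : 'S_n.+2) :
  s \in inv132 n.+2 -> s ord_max != ord_max ->
  exists t (m : 'I_n.+1), [/\ t \in inv132 n, site t m & s = cyc_ins m t].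
Proof.
move=> sV smax; have [sK _] := inv132P _ sV.
have [m sm] : exists m : 'I_n.+1, s ord_max = lift ord_max m.
  by case: (ord_lastP (s ord_max)) smax => [->|m ->]; [rewrite eqxx|exists m].
have [t st] := lift_perm_ex sm.
have tm : t m = ord_max.
  have := lift_perm_lift ord_max (lift ord_max m) t m; rewrite -st -sm sK.
  case: (ord_lastP (t m)) => [//|k ->] /(congr1 val) /=.
  have := ltn_ord k; have := ltn_ord m; rewrite /bump; lia.
have [r tr] := lift_perm_ex tm.
have sE : s = cyc_ins m r by rewrite st tr.
by exists r, m; move: sV; rewrite sE cyc_ins_inv132 => /andP[].
Qed.

Lemma sum_inv132 n (F : 'S_n.+2 -> nat) :
  \sum_(s in inv132 n.+2) F s =
    \sum_(s in inv132 n.+1) F (fix_ins s) +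
    \sum_(s in inv132 n) \sum_(m < n.+1 | site s m) F (cyc_ins m s).
Proof.
rewrite (bigID (fun s : 'S_n.+2 => s ord_max == ord_max)) /=; congr (_ + _).
  rewrite -(big_imset (h := @fix_ins n.+1)) /=; last first.
    by move=> s t _ _; apply: lift_perm_inj.
  apply: eq_bigl => s; apply/andP/imsetP => [[sV /eqP]|[t tV ->]].
    exact: fix_ins_ex.
  by rewrite fix_ins_last fix_ins_inv132.
rewrite pair_big_dep /=.
rewrite -(big_imset
  (A := [pred p : 'S_n * 'I_n.+1 | (p.1 \in inv132 n) && site p.1 p.2])
  (h := fun p : 'S_n * 'I_n.+1 => cyc_ins p.2 p.1) F) /=; last first.
  (* The cycle is recovered from the last value, so insertion is injective. *)
  move=> [s m] [t p] _ _ /= st.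
  have /lift_inj mp : lift ord_max m = lift ord_max p :> 'I_n.+2.
    by rewrite -(cyc_ins_last m s) -(cyc_ins_last p t) st.
  by move: st; rewrite mp => /lift_perm_inj/lift_perm_inj ->.
apply: eq_bigl => s; apply/andP/imsetP => [[sV smax]|[[t m] tV ->]]; last first.
  by rewrite cyc_ins_inv132 cyc_ins_last eq_sym neq_lift.
have [t [m [tV tm ->]]] := cyc_ins_ex sV smax.
by exists (t, m); rewrite // inE tV.
Qed.

(** As m runs through the sites, the number of sites from m on takes each value from 1 to their
    total once. Cycle insertions into an involution with c sites thus give 2, ..., c + 1 sites. *)
Lemma sum_count_geq (P : pred nat) (g : nat -> nat) a N :
  \sum_(m <- iota a N | P m) g (count (fun p => (m <= p) && P p) (iota a N)) =
  \sum_(i < count P (iota a N)) g i.+1.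
Proof.
elim: N a => [|N IH] a; first by rewrite big_nil big_ord0.
rewrite [iota a N.+1]/= big_cons /= leqnn /=.
have -> : \sum_(m <- iota a.+1 N | P m)
    g ((m <= a) && P a + count (fun p => (m <= p) && P p) (iota a.+1 N)) =
  \sum_(i < count P (iota a.+1 N)) g i.+1.
  rewrite -IH big_seq_cond [RHS]big_seq_cond; apply: eq_bigr => m.
  by rewrite mem_iota => /andP[/andP[am _] _]; rewrite leqNgt am.
case: (P a) => //=; rewrite add1n big_ord_recr addnC /=; congr (_ + g _.+1).
apply: eq_in_count => p; rewrite mem_iota => /andP[ap _].
by rewrite (ltnW ap).
Qed.

(** * Recurrences in the number of sites *)

Lemma nsites_gt0 n (s : 'S_n) : 0 < nsites s.
Proof. by rewrite -has_count; apply/hasP; exists 0; rewrite ?site0. Qed.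

Lemma nsites_le n (s : 'S_n) : nsites s <= n.+1.
Proof. by rewrite -[leqRHS](size_iota 0) count_size. Qed.

Definition nfix_sites (n k t : nat) : nat :=
  \sum_(s in inv132 n) ((nfix s == k) && (t <= nsites s)).

Lemma nfix_sites_rec n k t :
  nfix_sites n.+2 k t =
    \sum_(s in inv132 n.+1) (((nfix s).+1 == k) && (t <= 1)) +
    \sum_(s in inv132 n | nfix s == k) \sum_(i < nsites s) (t <= i.+2).
Proof.
rewrite /nfix_sites sum_inv132; congr (_ + _).
  by apply: eq_bigr => s _; rewrite nfix_fix_ins nsites_fix_ins.
rewrite [RHS]big_mkcondr; apply: eq_bigr => s _; case: eqP => [sk|/eqP sk].
  rewrite -(sum_count_geq (site s) (fun c => t <= c.+1)).
  rewrite -[n.+1]/(n.+1 - 0) -/(index_iota 0 _) big_mkord.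
  by apply: eq_bigr => m sm; rewrite nfix_cyc_ins sk eqxx nsites_cyc_ins.
by rewrite big1 // => m _; rewrite nfix_cyc_ins (negPf sk).
Qed.

(** A cycle insertion always gives at least two sites, so exactly one site means that the last point
    is fixed. *)
Lemma nfix_sites_rec1 n k :
  nfix_sites n.+2 k 1 =
    (if k is k'.+1 then nfix_sites n.+1 k' 1 else 0) + nfix_sites n.+2 k 2.
Proof.
rewrite !nfix_sites_rec [in RHS]big1 ?add0n => [|s _]; last by rewrite andbF.
congr (_ + _); case: k => [|k]; first by rewrite big1.
by rewrite /nfix_sites; apply: eq_bigr => s _; rewrite eqSS nsites_gt0.
Qed.

(** Of the cycle insertions, with 2, ..., c + 1 sites, c - t have at least t + 2. *)
Lemma nfix_sites_rec2 n k t :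
  nfix_sites n.+2 k t.+2 = \sum_(s in inv132 n | nfix s == k) (nsites s - t).
Proof.
rewrite nfix_sites_rec big1 ?add0n => [|s _]; last by rewrite andbF.
by apply: eq_bigr => s _; rewrite -sum_geq_ord.
Qed.

Lemma nfix_sites_recS n k t :
  nfix_sites n.+2 k t.+2 = nfix_sites n k t.+1 + nfix_sites n.+2 k t.+3.
Proof.
rewrite !nfix_sites_rec2 /nfix_sites !big_mkcondr -big_split /=.
by apply: eq_bigr => s _; case: eqP => //=; lia.
Qed.

(** * Ballot numbers as counts of involutions *)

Fixpoint ballot (n k : nat) : nat :=
  if n is n'.+1 then (if k is k'.+1 then ballot n' k' else 0) + ballot n' k.+1
  else k == 0.

Lemma nfix_sites0 k t : nfix_sites 0 k t = (k == 0) && (t <= 1).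
Proof.
have V0 : (1%g : 'S_0) \in inv132 0 by apply/inv132P; split=> -[].
rewrite /nfix_sites (big_pred1 1%g) => [|s].
  by rewrite /nfix big_ord0 eq_sym /nsites /= site0.
by rewrite [s]permS0 V0 /= eqxx.
Qed.

Lemma nfix_sites1 k t : nfix_sites 1 k t = (k == 1) && (t <= 1).
Proof.
have V0 : (1%g : 'S_0) \in inv132 0 by apply/inv132P; split=> -[].
rewrite /nfix_sites (big_pred1 (fix_ins (1%g : 'S_0))) => [|s].
  by rewrite nfix_fix_ins nsites_fix_ins /nfix big_ord0 eq_sym.
have V1 : (1%g : 'S_1) \in inv132 1.
  by rewrite -(permS1 (fix_ins 1)) fix_ins_inv132.
by rewrite [s]permS1 V1 /= [fix_ins 1]permS1 eqxx.
Qed.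

(** Strong induction on the size, with an inner induction on [d], hence downwards in [t]:
    [nfix_sites_rec1] and [nfix_sites_recS] both become the recursion of [ballot]. *)
Lemma nfix_sitesE n k t d :
  t + d = n -> nfix_sites n k t.+1 = ballot d (k + t).
Proof.
elim/ltn_ind: n k t d => -[|[|n]] IH k t d.
- by case: t => [|//]; case: d => // _; rewrite nfix_sites0 addn0 andbT.
- case: t => [|[|//]]; case: d => [|[|//]] // _; rewrite nfix_sites1 /=.
    by case: k => [|[|k]].
  by rewrite addn1 andbF.
elim: d k t => [|d IHd] k t.
  rewrite addn0 => ->; rewrite nfix_sites_rec2 addnS /=.
  by rewrite big1 // => s _; apply/eqP; rewrite subn_eq0 nsites_le.
case: t => [|t] tdn.
  rewrite nfix_sites_rec1 IHd; last by lia.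
  rewrite addn0 addn1 /=; case: k => [//|k].
  by rewrite (IH n.+1 _ k 0 d) ?addn0 //; lia.
rewrite nfix_sites_recS IHd; last by lia.
by rewrite (IH n _ k t d) ?addnS //; lia.
Qed.

Lemma sum_nfix_inv132 n k : \sum_(s in inv132 n) (nfix s == k) = ballot n k.
Proof.
rewrite -[k in RHS]addn0 -(@nfix_sitesE n k 0 n) //.
by apply: eq_bigr => s _; rewrite nsites_gt0 andbT.
Qed.

(** Here j is the number of 2-cycles: a fixed point changes neither j nor the sign, a cycle
    insertion raises j by one and flips the sign. *)
Lemma inv132_parity n (s : 'S_n) :
  s \in inv132 n -> exists2 j, n = nfix s + j.*2 & odd_perm s = odd j.
Proof.
have fixP k (t : 'S_k) : (exists2 j, k = nfix t + j.*2 & odd_perm t = odd j) ->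
    exists2 j, k.+1 = nfix (fix_ins t) + j.*2 & odd_perm (fix_ins t) = odd j.
  by case=> j kE tj; exists j; rewrite ?nfix_fix_ins ?odd_fix_ins // {1}kE.
elim/ltn_ind: n s => -[|[|n]] IH s sV.
- by exists 0; rewrite ?[s]permS0 ?odd_perm1 // /nfix big_ord0.
- have [|t tV ->] := fix_ins_ex sV; first by rewrite [s]permS1 perm1.
  exact/fixP/IH.
have [/fix_ins_ex[//|t tV ->]|smax] := eqVneq (s ord_max) ord_max.
  exact/fixP/IH.
have [t [m [tV _ ->]]] := cyc_ins_ex sV smax.
have [//||j nE tj] := IH n _ t; first lia.
by exists j.+1; rewrite ?nfix_cyc_ins ?odd_cyc_ins ?tj // {1}nE; lia.
Qed.

(** * Binomial form of the ballot numbers and the sum over a fixed parity *)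

Lemma ballot_small n k : n < k -> ballot n k = 0.
Proof.
by elim: n k => [|n IH] [|k] //= nk; rewrite !IH //; lia.
Qed.

(** The reflection formula, stated additively because natural subtraction truncates; the conditional
    term is the binomial with lower index j - 1, zero at j = 0. Pascal's rule drives the
    induction. *)
Lemma ballot_bin k j :
  ballot (k + j.*2) k + (if j is i.+1 then 'C(k + j.*2, i) else 0) =
    'C(k + j.*2, j).
Proof.
move nE: (k + j.*2) => n; elim: n k j nE => [|n IH] k j nE.
  by case: k j nE => [|k] [|j].
case: k nE => [|k] nE.
  case: j nE => [//|j] nE; have := IH 1 j ltac:(lia); rewrite /= binS.
  (* Here n = 2j + 1, so the two middle binomials agree. *)
  have -> : 'C(n, j.+1) = 'C(n, j) by rewrite -bin_sub; [congr 'C(_, _)|]; lia.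
  by case: j {nE} => [|j]; rewrite ?bin0 ?binS; lia.
have := IH k j ltac:(lia); case: j nE => [|j] nE.
  rewrite /= !bin0; rewrite (@ballot_small n k.+2); lia.
have := IH k.+2 j ltac:(lia); rewrite /= binS.
by case: j {nE} => [|j]; rewrite ?bin0 ?binS; lia.
Qed.

Lemma sum_ballot n J : J.*2 <= n.+1 ->
  \sum_(j < J.+1 | odd j == odd J) ballot n.+1 (n.+1 - j.*2) = 'C(n, J).
Proof.
have bE j : j.*2 <= n.+1 ->
    ballot n.+1 (n.+1 - j.*2) + (if j is i.+1 then 'C(n.+1, i) else 0) =
    'C(n.+1, j).
  by move=> jn; have := ballot_bin (n.+1 - j.*2) j; rewrite subnK.
(* From here on only the closed form is used; each term is C(n, j) - C(n, j - 2), so the induction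
   goes by steps of two. *)
move: (ballot n.+1) bE => b bE Jn; elim/ltn_ind: J Jn => -[|[|J]] IH Jn.
- rewrite big_mkcond big_ord_recr big_ord0 /=; have := bE 0 Jn.
  by rewrite !bin0; lia.
- rewrite big_mkcond !big_ord_recr big_ord0 /=; have := bE 1 Jn.
  by rewrite bin0 !bin1; lia.
rewrite big_mkcond 2!big_ord_recr -big_mkcond /= !negbK eqxx.
have -> : (~~ odd J == odd J) = false by case: (odd J).
rewrite IH; [|lia|lia]; have := bE J.+2 Jn; rewrite !binS; lia.
Qed.

(** The bounds make J the largest number of 2-cycles of its parity that fits into n + 1 points, so
    the sum in [sum_ballot] misses no involution. *)
Lemma card_inv132_parity n J : J.*2 <= n.+1 < J.*2 + 4 ->
  #|[set s in inv132 n.+1 | odd #|inversions s| == odd J]| = 'C(n, J).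
Proof.
move=> /andP[Jn nJ]; rewrite -sum_ballot //.
(* Double counting: an involution is counted at the index equal to its number of 2-cycles. *)
under [RHS]eq_bigr do rewrite -sum_nfix_inv132.
rewrite exchange_big -sum1dep_card big_mkcondr; apply: eq_bigr => s sV.
rewrite odd_inversions; have [j nE ->] := inv132_parity sV.
have jE (i : 'I_J.+1) : (nfix s == n.+1 - i.*2) = (i == j :> nat).
  by have iJ := ltn_ord i; apply/eqP/eqP; lia.
case: eqP => [jJ|jJ]; last first.
  rewrite big1 // => i /= /eqP iJ; rewrite jE; case: eqP => // ij.
  by case: jJ; rewrite -ij.
(* j has the parity of J and is less than J + 2. *)
have jltJ : j < J.+1 by lia.
rewrite (bigD1 (Ordinal jltJ)) ?jJ // jE eqxx big1 // => i /andP[_ ij].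
by rewrite jE; case: eqP => // e; case/eqP: ij; apply: val_inj.
Qed.

Theorem theorem2p3 (n : nat) (hn : 1 <= n) :
  #|[set s in involutions_avoiding n pattern132 | even_permutation s]|
    = binz n.-1 (2 * ((n%:Z + 1) %/ 4)%Z)%R
  /\
  #|[set s in involutions_avoiding n pattern132 | odd_permutation s]|
    = binz n.-1 (1 + 2 * ((n%:Z - 2) %/ 4)%Z)%R.
Proof.
case: n hn => // n _; rewrite [n.+1.-1]/=; split.
  have -> : (2 * ((n.+1%:Z + 1) %/ 4)%Z)%R = Posz (2 * ((n.+1 + 1) %/ 4)).
    by rewrite -PoszD divz_nat -PoszM.
  rewrite [RHS]/=.
  (* The two lower indices differ only when the size is 3 modulo 4, and then they add up to n. *)
  have -> : 'C(n, 2 * ((n.+1 + 1) %/ 4)) = 'C(n, (n.+1 %/ 4).*2).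
    have [n3|n3] := eqVneq (n.+1 %% 4) 3; last by congr 'C(_, _); lia.
    by rewrite -bin_sub; [congr 'C(_, _)|]; lia.
  rewrite -card_inv132_parity; last by lia.
  apply: eq_card => s; rewrite !inE /even_permutation odd_double.
  by rewrite eqbF_neg.
(* For size 1 the floor of -1/4 is -1, so the lower index is -1 and the count must be 0. *)
case: n => [|n].
  rewrite [RHS]/=; apply/eqP; rewrite cards_eq0 -subset0.
  apply/subsetP => s; rewrite inE /odd_permutation odd_inversions.
  by rewrite [s]permS1 odd_perm1 andbF.
have -> : (1 + 2 * ((n.+2%:Z - 2) %/ 4)%Z)%R = Posz (1 + 2 * (n %/ 4)).
  have -> : (n.+2%:Z - 2 = n%:Z)%R by lia.
  by rewrite divz_nat -PoszM -PoszD.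
rewrite [RHS]/= -card_inv132_parity; last by lia.
apply: eq_card => s; rewrite !inE /odd_permutation.
by rewrite oddD oddM eqb_id.
Qed.
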